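(* For all $n\ge2$, we have $c_n(132,231)=2^n$.
   Context: A word $\pi=\pi_1\dots\pi_m$ over the positive integers contains the pattern $\sigma=\sigma_1\dots\sigma_k$ if there are indices $1\le i_1<\dots<i_k\le m$ such that for all $r,s\in\{1,\dots,k\}$: $\pi_{i_r}<\pi_{i_s}$ iff $\sigma_r<\sigma_s$, and $\pi_{i_r}=\pi_{i_s}$ iff $\sigma_r=\sigma_s$; otherwise $\pi$ avoids $\sigma$. $\mathcal{C}_n$ denotes the set of nonnesting permutations: arrangements (words) of the multiset $\{1,1,2,2,\dots,n,n\}$ that avoid the patterns $1221$ and $2112$. For patterns $\sigma,\tau,\dots$, $c_n(\sigma,\tau,\dots)$ is the number of $\pi\in\mathcal{C}_n$ avoiding all of $\sigma,\tau,\dots$. *)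

(* Defs.v *)
From mathcomp Require Import all_boot.

Set Implicit Arguments.
Unset Strict Implicit.
Unset Printing Implicit Defensive.

(* Words are sequences of natural numbers; positions are counted from 0, and
   [f] lists the chosen positions i_1 < ... < i_k. *)
Definition contains (w sigma : seq nat) : bool :=
  [exists f : {ffun 'I_(size sigma) -> 'I_(size w)},
    [forall r : 'I_(size sigma), forall s : 'I_(size sigma),
      [&& (r < s) ==> (f r < f s),
          (nth 0 w (f r) < nth 0 w (f s)) ==
            (nth 0 sigma r < nth 0 sigma s)
        & (nth 0 w (f r) == nth 0 w (f s)) ==
            (nth 0 sigma r == nth 0 sigma s)]]].

Definition avoids (w sigma : seq nat) : bool := ~~ contains w sigma.

Definition avoids_all (patterns : seq (seq nat)) (w : seq nat) : bool :=
  all (avoids w) patterns.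

Definition double_word (n : nat) : seq nat :=
  flatten [seq [:: i; i] | i <- iota 1 n].

(* [permutations s] is duplicate-free even when [s] has repeated letters, so
   sizes of the lists below count distinct words. *)
Definition nonnesting (n : nat) : seq (seq nat) :=
  [seq w <- permutations (double_word n)
     | avoids_all [:: [:: 1; 2; 2; 1]; [:: 2; 1; 1; 2]] w].

Definition c (n : nat) (patterns : seq (seq nat)) : nat :=
  size [seq w <- nonnesting n | avoids_all patterns w].

(* Main.v *)
Require Import Defs.
From mathcomp Require Import all_boot.

(** Call a word admissible if it avoids 1221, 2112, 132 and 231.  The largest
    letter [x] of an admissible word with letters 1, 1, 2, 2, and so on up to
    [x], [x], where [3 <= x], has its two copies adjacent, at the beginning or at the end of the word.
    Indeed a copy of [x] with smaller letters [a] on its left and [c] on its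
    right, [a <> c], is an occurrence of 132 or 231.  As the smaller letters
    take at least two values, each copy of [x] has smaller letters on at most one
    side ([peak_free_side]); the copies cannot sit at opposite ends, since a
    smaller letter repeated between them would be an occurrence of 2112
    ([max_pair_at_end]).

    Conversely the two copies of [x] can be put at either end of any admissible
    word on the smaller letters: in each of the four patterns some occurrence
    of the maximum has a smaller letter before it, and some occurrence has one
    after it, so no occurrence of a pattern can use [x] ([contains_max_pair],
    transported to the right end by reversal).

    Hence the number of admissible words doubles from [n] to [n.+1] as soon as
    [2 <= n] ([admissible_wordsS]).  For [n = 2] only 1221 and 2112 are lost
    among the six arrangements, which leaves four words. *)

(** * Pattern containment through subwords *)

Definition order_iso (sigma t : seq nat) : bool :=
  (size t == size sigma) &&
  all (fun r => all (fun s =>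
    ((nth 0 t r < nth 0 t s) == (nth 0 sigma r < nth 0 sigma s)) &&
    ((nth 0 t r == nth 0 t s) == (nth 0 sigma r == nth 0 sigma s)))
    (iota 0 (size sigma))) (iota 0 (size sigma)).

Fixpoint subwords (w : seq nat) : seq (seq nat) :=
  if w is x :: w' then map (cons x) (subwords w') ++ subwords w' else [:: [::]].

Lemma order_isoP {sigma t} :
  reflect (size t = size sigma /\
           forall r s, r < size sigma -> s < size sigma ->
             (nth 0 t r < nth 0 t s) = (nth 0 sigma r < nth 0 sigma s) /\
             (nth 0 t r == nth 0 t s) = (nth 0 sigma r == nth 0 sigma s))
          (order_iso sigma t).
Proof.
apply: (iffP andP) => [[/eqP-> iso]|[sz iso]]; split=> //.
- move=> r s lt_r lt_s; move/allP/(_ r): iso.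
  rewrite mem_iota => /(_ lt_r)/allP/(_ s); rewrite mem_iota.
  by move=> /(_ lt_s)/andP[/eqP ? /eqP ?].
- exact/eqP.
apply/allP=> r; rewrite mem_iota => /andP[_ lt_r].
apply/allP=> s; rewrite mem_iota => /andP[_ lt_s].
by have [-> ->] := iso r s lt_r lt_s; rewrite !eqxx.
Qed.

Lemma mem_subwords (t w : seq nat) : (t \in subwords w) = subseq t w.
Proof.
elim: w t => [|x w IHw] [|y t] //=.
- by rewrite mem_cat IHw sub0seq orbT.
rewrite mem_cat IHw; case: eqVneq => [->|neq_yx].
- rewrite mem_map => [|u v [] //]; rewrite IHw; apply/orP/idP => [[] //|]; last by left.
  exact/subseq_trans/subseq_cons.
by case: mapP => // -[u _ [eq_yx]]; rewrite eq_yx eqxx in neq_yx.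
Qed.

Lemma subseq_indices (t w : seq nat) :
  subseq t w -> exists2 idx, subseq idx (iota 0 (size w)) & t = map (nth 0 w) idx.
Proof.
case/subseqP=> m sz_m ->; exists (mask m (iota 0 (size w))); first exact: mask_subseq.
by rewrite map_mask -/(mkseq _ _) mkseq_nth.
Qed.

(** Occurrences as subwords instead of position functions: subwords compose
    with concatenation and reversal, and they can be enumerated. *)
Lemma containsE (w sigma : seq nat) :
  contains w sigma = has (order_iso sigma) (subwords w).
Proof.
apply/existsP/hasP => [[f /forallP iso]|[t]].
- have fP r s := and3P (forallP (iso r) s).
  pose idx := [seq val (f r) | r <- enum 'I_(size sigma)].
  have sz_idx : size idx = size sigma by rewrite size_map size_enum_ord.
  have nth_idx (r : 'I_(size sigma)) : nth 0 idx r = f r.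
    by rewrite (nth_map r) ?size_enum_ord // nth_ord_enum.
  exists (map (nth 0 w) idx).
    rewrite mem_subwords -{2}(mkseq_nth 0 w) map_subseq //.
    have <- : [seq i <- iota 0 (size w) | i \in idx] = idx.
      apply: (irr_sorted_eq ltn_trans ltnn).
      - exact: sorted_filter ltn_trans _ _ (iota_ltn_sorted _ _).
      - apply/(sortedP 0) => i; rewrite sz_idx => lt_i.
        have [+ _ _] := fP (Ordinal (ltnW lt_i)) (Ordinal lt_i).
        by rewrite -!nth_idx /= ltnSn.
      move=> i; rewrite mem_filter mem_iota /= add0n.
      by case: mapP => // -[r _ ->]; rewrite ltn_ord.
    exact: filter_subseq.
  apply/order_isoP; rewrite size_map sz_idx; split=> // r s lt_r lt_s.
  rewrite !(nth_map 0) ?sz_idx //.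
  have [_ /eqP + /eqP] := fP (Ordinal lt_r) (Ordinal lt_s).
  by rewrite -!nth_idx.
rewrite mem_subwords => /subseq_indices[idx sub_idx ->] /order_isoP[].
rewrite size_map => sz_idx iso.
have lt_idx (r : 'I_(size sigma)) : nth 0 idx r < size w.
  have := mem_subseq sub_idx (mem_nth 0 _); rewrite sz_idx => /(_ r (ltn_ord r)).
  by rewrite mem_iota.
exists [ffun r => Ordinal (lt_idx r)].
apply/forallP=> r; apply/forallP=> s; rewrite !ffunE /=.
have [] := iso r s (ltn_ord r) (ltn_ord s).
rewrite !(nth_map 0) ?sz_idx // => -> ->; rewrite !eqxx !andbT.
apply/implyP => lt_rs.
have idx_sorted : sorted ltn idx.
  exact: (subseq_sorted ltn_trans sub_idx (iota_ltn_sorted _ _)).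
by rewrite (sorted_ltn_nth ltn_trans) // inE sz_idx.
Qed.

Lemma containsP {w sigma : seq nat} :
  reflect (exists2 t, subseq t w & order_iso sigma t) (contains w sigma).
Proof.
rewrite containsE; apply: (iffP hasP) => -[t].
- by rewrite mem_subwords; exists t.
by exists t; rewrite ?mem_subwords.
Qed.

Lemma contains_rev (w sigma : seq nat) :
  contains (rev w) (rev sigma) = contains w sigma.
Proof.
suff rev_imp v tau : contains v tau -> contains (rev v) (rev tau).
  by apply/idP/idP => /rev_imp //; rewrite !revK.
case/containsP=> t sub_t /order_isoP[sz iso]; apply/containsP.
exists (rev t); first by rewrite subseq_rev.
apply/order_isoP; rewrite !size_rev sz; split=> // r s lt_r lt_s.
have lt_rev i : i < size tau -> size tau - i.+1 < size tau.
  by move=> lt_i; rewrite ltn_subrL (leq_ltn_trans _ lt_i).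
by rewrite !nth_rev ?sz //; apply: iso; apply: lt_rev.
Qed.

Lemma contains_subseq (v w sigma : seq nat) :
  subseq v w -> contains v sigma -> contains w sigma.
Proof.
move=> sub_v /containsP[t sub_t iso]; apply/containsP.
by exists t => //; apply: subseq_trans sub_t sub_v.
Qed.

(** * The position of the largest letter *)

(** The pattern supplies a maximal entry, at [s], preceded by a smaller one, at
    [r].  In an occurrence using [x], that entry would be a copy of [x]
    preceded by another letter, whereas only copies of [x] precede [x] here. *)
Lemma contains_max_pair (x : nat) (w sigma : seq nat) (r s : nat) :
    all (ltn^~ x) w ->
    r < s < size sigma -> nth 0 sigma r < nth 0 sigma s ->
    all (leq^~ (nth 0 sigma s)) sigma ->
  contains [:: x, x & w] sigma = contains w sigma.
Proof.
move=> w_lt /andP[lt_rs lt_s] sigma_rs sigma_max.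
have x_notin : x \notin w by apply/negP=> /(allP w_lt) /=; rewrite ltnn.
have w_filter : [seq y <- [:: x, x & w] | y != x] = w.
  rewrite /= eqxx /=; apply/all_filterP/allP=> y y_in.
  by apply: contra x_notin => /eqP <-.
apply/idP/idP; last by apply: contains_subseq; rewrite -[_ :: _]/([:: x; x] ++ w) suffix_subseq.
case/containsP=> t sub_t iso_t; have [sz iso] := order_isoP iso_t.
apply/containsP; exists t => //.
suff x_notin_t : x \notin t.
  rewrite -w_filter subseq_filter sub_t andbT.
  by apply/allP=> y y_in; apply: contra x_notin_t => /eqP <-.
apply/negP=> x_in.
have lt_r := ltn_trans lt_rs lt_s.
have t_le y : y \in t -> y <= x.
  move/(mem_subseq sub_t); rewrite !inE => /or3P[/eqP->|/eqP->|/(allP w_lt)] //.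
  exact: ltnW.
have ts_x : nth 0 t s = x.
  apply/eqP; rewrite eqn_leq t_le ?mem_nth ?sz //= leqNgt.
  rewrite -(nth_index 0 x_in) (iso _ _ _ _).1 //; last by rewrite -sz index_mem.
  by rewrite -leqNgt (allP sigma_max) // mem_nth // -sz index_mem.
have tr_x : nth 0 t r != x by rewrite -ts_x neq_ltn (iso r s _ _).1 // sigma_rs.
have sub_rs : subseq [:: nth 0 t r; nth 0 t s] t.
  rewrite -{3}(cat_take_drop s t) -[X in subseq X]/([:: nth 0 t r] ++ [:: nth 0 t s]).
  rewrite cat_subseq // sub1seq; last by rewrite (drop_nth 0) ?sz ?mem_head.
  by rewrite -(nth_take _ lt_rs) mem_nth // size_takel ?sz // ltnW.
have := subseq_trans sub_rs sub_t.
rewrite ts_x /= (negPf tr_x) /= (negPf tr_x) => /mem_subseq/(_ x).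
by rewrite !inE eqxx orbT (negPf x_notin) => /(_ isT).
Qed.

Definition forbidden : seq (seq nat) :=
  [:: [:: 1; 2; 2; 1]; [:: 2; 1; 1; 2]; [:: 1; 3; 2]; [:: 2; 3; 1]].

(** 1221 and 2112 are palindromes, and 132 and 231 are reversals of each other,
    so the left and right ends of a word play symmetric roles. *)
Lemma admissible_rev (w : seq nat) :
  avoids_all forbidden (rev w) = avoids_all forbidden w.
Proof.
rewrite /avoids_all /= /avoids.
rewrite -(contains_rev w [:: 1; 2; 2; 1]) -(contains_rev w [:: 2; 1; 1; 2]).
rewrite -(contains_rev w [:: 1; 3; 2]) -(contains_rev w [:: 2; 3; 1]) /=.
by rewrite !andbT; congr [&& _, _ & _]; rewrite andbC.
Qed.

Lemma admissible_max_pair (x : nat) (w : seq nat) :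
  all (ltn^~ x) w ->
  avoids_all forbidden [:: x, x & w] = avoids_all forbidden w.
Proof.
move=> w_lt; rewrite /avoids_all /= /avoids.
rewrite (@contains_max_pair _ _ [:: 1; 2; 2; 1] 0 1) //.
(* 2112 begins with a maximum, so its final 2 is the one to use. *)
rewrite (@contains_max_pair _ _ [:: 2; 1; 1; 2] 1 3) //.
rewrite (@contains_max_pair _ _ [:: 1; 3; 2] 0 1) //.
by rewrite (@contains_max_pair _ _ [:: 2; 3; 1] 0 1).
Qed.

Lemma admissible_max_pair_last (x : nat) (w : seq nat) :
  all (ltn^~ x) w ->
  avoids_all forbidden (w ++ [:: x; x]) = avoids_all forbidden w.
Proof.
move=> w_lt; rewrite -admissible_rev rev_cat admissible_max_pair ?admissible_rev //.
by rewrite all_rev.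
Qed.

Lemma ltn_cmpE {i j : nat} :
  i < j -> ((i < j) = true) * ((j < i) = false) * ((i == j) = false) * ((j == i) = false).
Proof. by case: ltngtP. Qed.

Lemma admissible_peak (w : seq nat) (a x e : nat) :
  avoids_all forbidden w -> subseq [:: a; x; e] w -> a < x -> e < x -> a = e.
Proof.
move=> /and5P[_ _ no132 no231 _] sub_w lt_ax lt_ex.
have [lt_ae|lt_ea|//] := ltngtP a e.
  case/negP: no132; apply/containsP; exists [:: a; x; e] => //.
  by rewrite /order_iso /= !eqxx !ltnn !(ltn_cmpE lt_ax, ltn_cmpE lt_ex, ltn_cmpE lt_ae).
case/negP: no231; apply/containsP; exists [:: a; x; e] => //.
by rewrite /order_iso /= !eqxx !ltnn !(ltn_cmpE lt_ax, ltn_cmpE lt_ex, ltn_cmpE lt_ea).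
Qed.

(** If smaller letters occurred on both sides of a copy of [x], avoiding 132
    and 231 would force them all to be equal. *)
Lemma peak_free_side (x y z : nat) (p q : seq nat) :
    avoids_all forbidden (p ++ x :: q) -> all (leq^~ x) (p ++ x :: q) ->
    y < x -> z < x -> y != z -> y \in p ++ x :: q -> z \in p ++ x :: q ->
  all (pred1 x) p \/ all (pred1 x) q.
Proof.
move=> adm le_x lt_yx lt_zx neq_yz y_in z_in.
have [|/allPn[a a_p neq_ax]] := boolP (all (pred1 x) p); first by left.
have [|/allPn[e e_q neq_ex]] := boolP (all (pred1 x) q); first by right.
have eq_sides u v : u \in p -> v \in q -> u < x -> v < x -> u = v.
  move=> u_p v_q; apply: admissible_peak adm _.
  by rewrite -[X in subseq X]/([:: u] ++ [:: x; v]) cat_subseq ?sub1seq //= eqxx sub1seq.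
have lt_ax : a < x.
  by rewrite ltn_neqAle neq_ax (allP le_x) // mem_cat a_p.
have lt_ex : e < x.
  by rewrite ltn_neqAle neq_ex (allP le_x) // mem_cat inE e_q !orbT.
have all_a u : u \in p ++ x :: q -> u < x -> u = a.
  rewrite mem_cat inE => /or3P[u_p|/eqP->|u_q] lt_ux; last by rewrite (eq_sides a u).
    by rewrite (eq_sides u e) // (eq_sides a e).
  by rewrite ltnn in lt_ux.
by case/eqP: neq_yz; rewrite (all_a y) // [RHS]all_a.
Qed.

Lemma count_mem2_split {x : nat} {w : seq nat} :
  count_mem x w = 2 ->
  exists p m q, w = p ++ x :: m ++ x :: q /\ x \notin p ++ m ++ q.
Proof.
move=> count_x; have x_w : x \in w by rewrite -has_pred1 has_count count_x.
case/splitPr: x_w count_x => p v; rewrite count_cat /= eqxx add1n => count_x.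
have [x_p|x_p] := boolP (x \in p).
  case/splitPr: x_p count_x => p1 p2; rewrite count_cat /= eqxx add1n.
  rewrite !(addSn, addnS) => -[count_x].
  exists p1, p2, v; rewrite -catA; split=> //; apply/count_memPn.
  by rewrite !count_cat addnA.
move: count_x; rewrite (count_memPn x_p) => -[count_v].
have x_v : x \in v by rewrite -has_pred1 has_count count_v.
case/splitPr: x_v count_v => v1 v2; rewrite count_cat /= eqxx add1n addnS => -[count_v].
exists p, v1, v2; split=> //; apply/count_memPn.
by rewrite !count_cat (count_memPn x_p).
Qed.

(** Write [w] as [p x m x q].  Applied to each copy of [x], [peak_free_side]
    leaves only the possibilities that all smaller letters lie in [p], in [q] or
    in [m].  The last one is excluded by 2112: this is what the two copies of
    [y] are for, while [z] is there to give a second value. *)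
Lemma max_pair_at_end (x y z : nat) (w : seq nat) :
    avoids_all forbidden w -> all (leq^~ x) w -> count_mem x w = 2 ->
    y < x -> z < x -> y != z -> count_mem y w = 2 -> z \in w ->
  exists2 v, all (ltn^~ x) v & w = [:: x, x & v] \/ w = v ++ [:: x; x].
Proof.
move=> adm le_x count_x lt_yx lt_zx neq_yz count_y z_w.
have y_w : y \in w by rewrite -has_pred1 has_count count_y.
have [p [m [q [def_w x_notin]]]] := count_mem2_split count_x.
have mem_w u : u \in w = (u == x) || (u \in p ++ m ++ q).
  by rewrite def_w !(mem_cat, inE); case: (u == x); rewrite ?orbT.
have lt_x u : u \in p ++ m ++ q -> u < x.
  move=> u_in; rewrite ltn_neqAle (allP le_x) ?mem_w ?u_in ?orbT // andbT.
  by apply: contra x_notin => /eqP <-.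
have no_x s : {subset s <= p ++ m ++ q} -> all (pred1 x) s -> s = [::].
  case: s => //= u s sub_s /andP[/eqP eq_ux _]; case/negP: x_notin.
  by rewrite -eq_ux sub_s ?mem_head.
have side1 : p = [::] \/ all (pred1 x) (m ++ x :: q).
  have := @peak_free_side x y z p (m ++ x :: q); rewrite -def_w.
  case=> // [sub_p|]; [left | by right].
  by apply: no_x sub_p => u; rewrite mem_cat => ->.
have side2 : all (pred1 x) (p ++ x :: m) \/ q = [::].
  have := @peak_free_side x y z (p ++ x :: m) q; rewrite -catA -def_w.
  case=> // [|sub_q]; [by left | right].
  by apply: no_x sub_q => u; rewrite !mem_cat => ->; rewrite !orbT.
have m_nil : all (pred1 x) m -> m = [::].
  by apply: no_x => u; rewrite !mem_cat => ->; rewrite orbT.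
case: side1 => [p_nil|]; last first.
  rewrite all_cat /= => /and3P[/m_nil m0 _ all_q].
  have q0 : q = [::] by apply: no_x all_q => u; rewrite !mem_cat => ->; rewrite !orbT.
  exists p; last by right; rewrite def_w m0 q0.
  by apply/allP=> u u_p; apply: lt_x; rewrite mem_cat u_p.
case: side2 => [|q_nil].
  rewrite p_nil /= => /andP[_ /m_nil m0].
  exists q; last by left; rewrite def_w p_nil m0.
  by apply/allP=> u u_q; apply: lt_x; rewrite !mem_cat u_q !orbT.
case/and5P: adm => _ /negP no2112 _ _ _; case: no2112.
apply/containsP; exists [:: x; y; y; x]; last first.
  by rewrite /order_iso /= !eqxx !ltnn !(ltn_cmpE lt_yx).
have sub_yy : subseq [:: y; y] m.
  have := filter_subseq (pred1 y) m; have/all_pred1P := filter_all (pred1 y) m.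
  rewrite size_filter => ->; suff -> : count_mem y m = 2 by [].
  move: count_y; rewrite def_w p_nil q_nil /= count_cat /=.
  by rewrite gtn_eqF // addn0 addn0.
rewrite def_w p_nil q_nil -[X in subseq X]/([:: x] ++ [:: y; y] ++ [:: x]).
by rewrite -[X in subseq _ X]/([:: x] ++ m ++ [:: x]) !cat_subseq.
Qed.

(** * Doubling *)

Definition admissible_words (n : nat) : seq (seq nat) :=
  [seq w <- permutations (double_word n) | avoids_all forbidden w].

Lemma double_wordS (n : nat) : double_word n.+1 = double_word n ++ [:: n.+1; n.+1].
Proof. by rewrite /double_word -[in LHS](addn1 n) iotaD map_cat flatten_cat add1n. Qed.

Lemma count_double_word (n i : nat) : count_mem i (double_word n) = (0 < i <= n).*2.
Proof.
elim: n => [|n IHn]; first by case: i.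
rewrite double_wordS count_cat IHn /= addn0 (leq_eqVlt i n.+1) ltnS.
by have [->|neq_i] := eqVneq i n.+1; rewrite ?ltnn // addn0.
Qed.

Lemma mem_double_word (n i : nat) : (i \in double_word n) = (0 < i <= n).
Proof. by rewrite -has_pred1 has_count count_double_word double_gt0 lt0b. Qed.

(** The base case is a computation, made possible by [containsE]: the search
    over finite functions in [contains] does not reduce in practice. *)
Lemma admissible_words2 : size (admissible_words 2) = 4.
Proof.
have computable w :
    avoids_all forbidden w = all (fun sigma => ~~ has (order_iso sigma) (subwords w)) forbidden.
  by rewrite /avoids_all; apply: eq_all => sigma; rewrite /avoids containsE.
by rewrite /admissible_words (eq_filter computable); vm_compute.
Qed.

(** Removing the pair [n.+1] from the end where it lies is inverse to adding it.
    The two ways of adding it give different words because the shorter word is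
    nonempty and so starts with a smaller letter. *)
Lemma admissible_wordsS {n : nat} :
  2 <= n ->
  perm_eq (admissible_words n.+1)
    ([seq [:: n.+1, n.+1 & w] | w <- admissible_words n]
      ++ [seq w ++ [:: n.+1; n.+1] | w <- admissible_words n]).
Proof.
move=> le2n.
have lt_words w : perm_eq w (double_word n) -> all (ltn^~ n.+1) w.
  move=> perm_w; rewrite (perm_all _ perm_w); apply/allP=> i.
  by rewrite mem_double_word => /andP[].
have mem_admissible k w :
    (w \in admissible_words k) = avoids_all forbidden w && perm_eq w (double_word k).
  by rewrite mem_filter mem_permutations.
have uniq_admissible k : uniq (admissible_words k).
  by rewrite filter_uniq // permutations_uniq.
apply: uniq_perm => //.
  rewrite cat_uniq !map_inj_uniq ?uniq_admissible ?andbT /=; last 2 first.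
  - by move=> u v /(congr1 rev); rewrite !rev_cat => -[] /(can_inj revK).
  - by move=> u v [].
  apply/hasPn=> _ /mapP[v v_adm ->]; apply/negP=> /mapP[u _].
  move: v_adm; rewrite mem_admissible => /andP[_ perm_v].
  have := lt_words v perm_v; case: v perm_v => [|i v] perm_v /=.
    by have /perm_mem/(_ 1) := perm_v; rewrite mem_double_word (ltnW le2n).
  by move=> /andP[+ _] [eq_i _]; rewrite eq_i ltnn.
have perm_first w : perm_eq [:: n.+1, n.+1 & w] (double_word n.+1) = perm_eq w (double_word n).
  by rewrite double_wordS perm_sym perm_catC !perm_cons perm_sym.
have perm_last w : perm_eq (w ++ [:: n.+1; n.+1]) (double_word n.+1) = perm_eq w (double_word n).
  by rewrite perm_catC perm_first.
move=> w; rewrite mem_cat mem_admissible; apply/andP/orP.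
  case=> adm_w perm_w.
  have count_w i : count_mem i w = (0 < i <= n.+1).*2.
    by rewrite (permP perm_w) count_double_word.
  have le_w : all (leq^~ n.+1) w.
    by rewrite (perm_all _ perm_w); apply/allP=> i; rewrite mem_double_word => /andP[].
  have [v lt_v def_w] :
      exists2 v, all (ltn^~ n.+1) v & w = [:: n.+1, n.+1 & v] \/ w = v ++ [:: n.+1; n.+1].
    by apply: (@max_pair_at_end _ 1 2);
      rewrite ?count_w ?(perm_mem perm_w) ?mem_double_word ?leqnn //= ltnW.
  by case: def_w adm_w perm_w => ->;
    rewrite ?(admissible_max_pair, admissible_max_pair_last) // ?(perm_first, perm_last)
      => adm_v perm_v; [left | right]; apply: map_f; rewrite mem_admissible adm_v.
by case=> /mapP[v + ->]; rewrite mem_admissible => /andP[adm_v perm_v];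
  rewrite ?(admissible_max_pair, admissible_max_pair_last) ?(perm_first, perm_last) ?lt_words.
Qed.

Lemma size_admissible_words (n : nat) : 2 <= n -> size (admissible_words n) = 2 ^ n.
Proof.
elim: n => // n IHn; rewrite leq_eqVlt => /predU1P[<-|lt2n]; first exact: admissible_words2.
by rewrite (perm_size (admissible_wordsS lt2n)) size_cat !size_map IHn // addnn expnS mul2n.
Qed.

Theorem theorem2p7 (n : nat) (hn : 2 <= n) :
  c n [:: [:: 1; 3; 2]; [:: 2; 3; 1]] = 2 ^ n.
Proof.
rewrite -size_admissible_words // /c /nonnesting /admissible_words -filter_predI.
by congr size; apply: eq_filter => w; rewrite /= /avoids_all /= !andbT andbC -!andbA.
Qed.
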